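(* Let $n\in\mathbb N$ be fixed and let $\mathcal X,\mathcal Y$ be finite alphabets. The set $$S^{FB}_{Stability}(\text{possible})=\{(A,W)\in \mathcal M_c^{n\times n}\times \mathcal{CH}_c(\mathcal X,\mathcal Y): \eta(A)<C_0^{FB}(W)\}\subset \mathcal M_c^{n\times n}\times \mathcal{CH}_c(\mathcal X,\mathcal Y)$$ is not semi-decidable (for channels with feedback).
   Context: Computability. A sequence of rationals $(r_k)_{k\in\mathbb N}$ is computable if there are partial recursive functions $a,b,s:\mathbb N\to\mathbb N$ with $b(k)\neq 0$ and $r_k=(-1)^{s(k)}a(k)/b(k)$ for all $k\in\mathbb N$. A real $x$ is computable if there is a computable sequence of rationals $(r_k)$ with $|x-r_k|<2^{-k}$ for all $k$; $\mathbb R_c$ is the set of computable reals. A computable real is given as input to a Turing machine by a description (a program) of such a sequence; computable matrices and computable channels are given by descriptions of all their entries. A subset $M$ of a set $D$ of such objects is semi-decidable if there is a Turing machine (with the single output state ''stop'') that, for every input in $D$, stops if the input lies in $M$ and computes forever if it does not. Plants. $\mathcal M_c^{n\times n}$ is the set of $n\times n$ matrices $A$ with entries in $\mathbb R_c$ that describe an unstable system, i.e. have at least one eigenvalue $\lambda$ with $|\lambda|\ge 1$. With $\lambda_1(A),\dots,\lambda_n(A)$ the (complex) eigenvalues of $A$ repeated according to algebraic multiplicity, $\eta(A)=\sum_{j:|\lambda_j(A)|\ge 1}\log_2|\lambda_j(A)|$. Channels. $\mathcal{CH}_c(\mathcal X,\mathcal Y)$ is the set of computable channels, i.e. families $W=(W(y|x))_{x\in\mathcal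 X,y\in\mathcal Y}$ such that for each $x$, $W(\cdot|x)$ is a probability distribution on $\mathcal Y$ with all values in $\mathbb R_c$. For $x^m\in\mathcal X^m$, $y^m\in\mathcal Y^m$ let $W^m(y^m|x^m)=\prod_{j=1}^m W(y_j|x_j)$. Let $M(W,m)$ be the maximum cardinality of a set of mutually orthogonal vectors (vectors with pairwise disjoint supports) among the $W^m(\cdot|x^m)$ with $x^m\in\mathcal X^m$. The zero-error capacity is $C_0(W)=\liminf_{m\to\infty}\frac1m\log_2 M(W,m)$. The zero-error capacity with feedback is given by (Shannon) $C_0^{FB}(W)=0$ if $C_0(W)=0$, and otherwise $$C_0^{FB}(W)=\max_{P}\min_{y\in\mathcal Y}\log_2\frac{1}{\sum_{x:W(y|x)>0}P(x)},$$ where $P$ ranges over all probability distributions on $\mathcal X$ (with $\log_2(1/0)=+\infty$).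
   Formalization: The theorem is stated for n ≥ 1 and alphabets with at least two letters each; for n = 0 there are no plants, and for one-letter alphabets the zero-error capacity is 0, so the set is empty and trivially semi-decidable. *)

(* Defs.v *)
From HB Require Import structures.
From mathcomp Require Import all_boot all_order all_algebra.
From mathcomp Require Import complex.
From mathcomp Require Import all_classical all_reals all_analysis.

Set Implicit Arguments.
Unset Strict Implicit.
Unset Printing Implicit Defensive.

Import Order.TTheory GRing.Theory Num.Theory.
Import numFieldNormedType.Exports.
Local Open Scope classical_set_scope.

(** * Partial recursive functions *)

(* Programs carry no arity: an argument list that is too short is padded
   with zeros by [PSucc] and [PProj]. *)
Inductive prog : Type :=
| PZero
| PSucc
| PProj of nat
| PComp of prog & seq prog
| PRec of prog & prog
| PMu of prog.

(* [computes p xs y]: the partial function denoted by [p] is defined at the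
   arguments [xs] and takes the value [y] there. *)
Inductive computes : prog -> seq nat -> nat -> Prop :=
| computes_zero xs : computes PZero xs 0
| computes_succ xs : computes PSucc xs (nth 0 xs 0).+1
| computes_proj i xs : computes (PProj i) xs (nth 0 xs i)
| computes_comp f gs xs ys y :
    computes_all gs xs ys -> computes f ys y -> computes (PComp f gs) xs y
| computes_rec0 f g xs y :
    computes f xs y -> computes (PRec f g) (0 :: xs) y
| computes_recS f g m xs y z :
    computes (PRec f g) (m :: xs) y -> computes g [:: m, y & xs] z ->
    computes (PRec f g) (m.+1 :: xs) z
| computes_mu f xs m :
    (forall i, (i < m)%N -> exists y, computes f (i :: xs) y.+1) ->
    computes f (m :: xs) 0 -> computes (PMu f) xs m
with computes_all : seq prog -> seq nat -> seq nat -> Prop :=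
| computes_all_nil xs : computes_all [::] xs [::]
| computes_all_cons g gs xs y ys :
    computes g xs y -> computes_all gs xs ys ->
    computes_all (g :: gs) xs (y :: ys).

(** * Turing machines *)

Inductive move : Type := MLeft | MStay | MRight.

(* Deterministic machines with one two-way infinite tape and binary input. *)
Record turing_machine : Type := TuringMachine {
  tm_state : finType;
  tm_symbol : finType;
  tm_start : tm_state;
  tm_stop : tm_state;
  tm_blank : tm_symbol;
  tm_input : bool -> tm_symbol;
  tm_input_inj : injective tm_input;
  tm_input_blank : forall b, tm_input b != tm_blank;
  tm_trans : tm_state -> tm_symbol -> tm_state * tm_symbol * move
}.

(* State, tape to the left of the head (nearest cell first), scanned symbol,
   tape to the right of the head; all other cells are blank. *)
Definition tm_config (T : turing_machine) : Type :=
  (tm_state T * seq (tm_symbol T) * tm_symbol T * seq (tm_symbol T))%type.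

Definition tm_step (T : turing_machine) (c : tm_config T) : tm_config T :=
  let: (q, l, a, r) := c in
  let: (q', b, d) := tm_trans q a in
  match d with
  | MLeft => (q', behead l, head (tm_blank T) l, b :: r)
  | MStay => (q', l, b, r)
  | MRight => (q', b :: l, head (tm_blank T) r, behead r)
  end.

Definition tm_init (T : turing_machine) (w : seq bool) : tm_config T :=
  let w' := [seq tm_input T b | b <- w] in
  (tm_start T, [::], head (tm_blank T) w', behead w').

Definition tm_stops (T : turing_machine) (w : seq bool) : Prop :=
  exists t : nat, (iter t (@tm_step T) (tm_init T w)).1.1.1 = tm_stop T.

(* [descr w x]: the word [w] is a description of the object [x].  An object
   may have many descriptions, and the machine has to be correct on each. *)
Definition semi_decidable (O : Type) (descr : seq bool -> O -> Prop)
    (D M : set O) : Prop :=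
  exists T : turing_machine, forall (x : O) (w : seq bool),
    D x -> descr w x ->
    (M x -> tm_stops T w) /\ (~ M x -> ~ tm_stops T w).

(** * Descriptions *)

(* Self-delimiting code of a number, and Polish notation for programs. *)
Definition encode_nat (m : nat) : seq bool := rcons (nseq m true) false.

Fixpoint encode_prog (p : prog) : seq bool :=
  match p with
  | PZero => encode_nat 0
  | PSucc => encode_nat 1
  | PProj i => encode_nat 2 ++ encode_nat i
  | PComp f gs => encode_nat 3 ++ encode_prog f ++ encode_nat (size gs) ++
                  flatten (map encode_prog gs)
  | PRec f g => encode_nat 4 ++ encode_prog f ++ encode_prog g
  | PMu f => encode_nat 5 ++ encode_prog f
  end.

Local Open Scope ring_scope.

(* Programs for a, b, s in r_k = (-1)^s(k) a(k) / b(k). *)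
Record real_descr : Type := RealDescr {
  rd_num : prog;
  rd_den : prog;
  rd_sgn : prog
}.

Definition encode_real_descr (d : real_descr) : seq bool :=
  encode_prog (rd_num d) ++ encode_prog (rd_den d) ++ encode_prog (rd_sgn d).

Definition describes_real (R : realType) (d : real_descr) (x : R) : Prop :=
  forall k : nat, exists a b s : nat,
    [/\ computes (rd_num d) [:: k] a, computes (rd_den d) [:: k] b,
        computes (rd_sgn d) [:: k] s, b != 0%N &
        `|x - (-1) ^+ s * a%:R / b%:R| < 2 ^- k].

Definition computable_real (R : realType) (x : R) : Prop :=
  exists d : real_descr, describes_real d x.

Definition describes_family (R : realType) (I J : finType)
    (w : seq bool) (F : I -> J -> R) : Prop :=
  exists d : I -> J -> real_descr,
    (forall i j, describes_real (d i j) (F i j)) /\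
    w = flatten [seq encode_real_descr (d i j) | i <- enum I, j <- enum J].

Definition describes_pair (R : realType) (n : nat) (X Y : finType)
    (w : seq bool) (AW : 'M[R]_n * (X -> Y -> R)) : Prop :=
  exists wA wW : seq bool,
    [/\ describes_family wA (fun i j => AW.1 i j),
        describes_family wW AW.2 & w = wA ++ wW].

Definition log2 (R : realType) (x : R) : R := ln x / ln 2.

(** * Plants *)

Definition complex_mx (R : realType) (n : nat) (A : 'M[R]_n) :
  'M[complex R]_n := map_mx (real_complex R) A.

Definition cabs (R : realType) (z : complex R) : R := ComplexField.Normc.normc z.

Definition computable_plant (R : realType) (n : nat) : set 'M[R]_n :=
  [set A : 'M[R]_n | (forall i j, computable_real (A i j)) /\
           (exists2 z : complex R, eigenvalue (complex_mx A) z & 1 <= cabs z)].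

(* The eigenvalues with algebraic multiplicity: the roots, in some order, of
   the (monic) characteristic polynomial. *)
Definition eigenvalues (R : realType) (n : nat) (A : 'M[R]_n) :
    seq (complex R) :=
  sval (closed_field_poly_normal (char_poly (complex_mx A))).

Definition eta (R : realType) (n : nat) (A : 'M[R]_n) : R :=
  \sum_(z <- eigenvalues A | 1 <= cabs z) log2 (cabs z).

(** * Channels *)

(* [W x y] is W(y|x). *)
Definition is_distribution (R : realType) (X : finType) (P : X -> R) : Prop :=
  (forall x, 0 <= P x) /\ \sum_x P x = 1.

Definition computable_channel (R : realType) (X Y : finType) :
    set (X -> Y -> R) :=
  [set W : X -> Y -> R | (forall x, is_distribution (W x)) /\
           (forall x y, computable_real (W x y))].

Definition block_channel (R : realType) (X Y : finType) (W : X -> Y -> R)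
    (m : nat) (x : m.-tuple X) (y : m.-tuple Y) : R :=
  \prod_(j < m) W (tnth x j) (tnth y j).

Definition orthogonal_words (R : realType) (X Y : finType) (W : X -> Y -> R)
    (m : nat) (x x' : m.-tuple X) : bool :=
  [forall y : m.-tuple Y,
    (block_channel W x y == 0) || (block_channel W x' y == 0)].

(* A set of mutually orthogonal vectors W^m(.|x) is given by the set of its
   indices x; this does not change cardinalities because the vectors are
   nonzero, so that orthogonal ones are distinct. *)
Definition max_orthogonal (R : realType) (X Y : finType) (W : X -> Y -> R)
    (m : nat) : nat :=
  \max_(S : {set m.-tuple X} |
      [forall x in S, forall x' in S, (x != x') ==> orthogonal_words W x x'])
    #|S|.

Definition C0 (R : realType) (X Y : finType) (W : X -> Y -> R) : \bar R :=
  limn_einf (fun m : nat => (log2 (max_orthogonal W m)%:R / m%:R)%:E).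

Definition log2_inv (R : realType) (s : R) : \bar R :=
  if s == 0 then +oo%E else (log2 (1 / s))%:E.

(* The maximum over P is written as a supremum; it is attained, since the
   simplex is compact. *)
Definition C0FB (R : realType) (X Y : finType) (W : X -> Y -> R) : \bar R :=
  if C0 W == 0%E then 0%E
  else ereal_sup
    [set \big[Order.min/+oo%E]_(y : Y) log2_inv (\sum_(x | 0 < W x y) P x)
       | P in [set P : X -> R | is_distribution P]].

Definition stability_possible_FB (R : realType) (n : nat) (X Y : finType) :
    set ('M[R]_n * (X -> Y -> R)) :=
  [set AW : 'M[R]_n * (X -> Y -> R) | [/\ computable_plant AW.1, computable_channel AW.2 &
             ((eta AW.1)%:E < C0FB AW.2)%E]].

(* Main.v *)
Require Import Defs.
From mathcomp Require Import all_boot all_order all_algebra.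
From mathcomp Require Import complex zify.
From mathcomp Require Import all_classical all_reals all_analysis.

(** Fix letters [x0 != x1] and [y0 != y1].  For [e] in [0, 1] let [W_e] send
    [x0] to [y0] with probability [1 - e] and to [y1] with probability [e], and
    send every other letter to [y1].  If [e = 0], then [x0] and [x1] never
    produce the same output, so the feedback capacity is at least 1.  If
    [e > 0], however small, then every letter can produce [y1]; no two words
    are orthogonal, the zero-error capacity vanishes, and so does the one with
    feedback ([C0FB_flip_channel0], [C0FB_flip_channel_gt0]).  The identity
    matrix is an unstable plant of entropy 0 ([eta_1]).  Hence, for computable
    [e], the pair [(1, W_e)] belongs to the set of the theorem if and only if
    [e = 0], and a machine that semi-decides the set recognises [e = 0] from any
    program that approximates [e].

    No machine [T] can do this, by diagonalisation.  A program [p] can rebuild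
    the word [w] that describes the pair [(1, W_e)] in terms of [p] itself
    ([self_reference]), and it can run [T] on [w] ([clockE]).  On input [k],
    let [p] return [2 ^ m], where [m] is the time at which [T] stops, cut off at
    [k + 1].  The quotients [1 / p(k)] converge at the required rate to a
    number [e], which is [2 ^ - t] if [T] stops on [w] at time [t] and 0 if it
    does not stop ([halting_real]).  So [T] stops on [w] if and only if [e > 0],
    while it should stop if and only if [e = 0].

    Self-reference is obtained in the manner of a quine.  The program is
    [f(k, c)] with a numeral substituted for [c], where [c] codes the source of
    [f].  The code of a numeral is a fixed word repeated [c] times, so [f] can
    write down the code of the whole program from [c] alone.  Words and tapes are
    numbers, through a pairing function with [<0, 0> = 0]: if 0 is also the
    code of the blank symbol, then the number 0 is an infinite blank tape, and
    reading beyond the written part of a tape needs no special treatment. *)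

Set Implicit Arguments.
Unset Strict Implicit.
Unset Printing Implicit Defensive.

Import Order.TTheory GRing.Theory Num.Theory.
Local Open Scope classical_set_scope.

(** * Functions computed by programs *)

(** Two arguments suffice throughout: a loop then has one parameter besides
    its state, and longer lists of data are handled by pairing. *)
Definition computable2 (f : nat -> nat -> nat) : Prop :=
  exists p, forall x y, computes p [:: x; y] (f x y).

Lemma computes_comp1 f g xs y z :
  computes g xs y -> computes f [:: y] z -> computes (PComp f [:: g]) xs z.
Proof.
move=> gP fP; apply: computes_comp fP.
by apply: computes_all_cons gP _; exact: computes_all_nil.
Qed.

Lemma computes_comp2 f g1 g2 xs y1 y2 z :
  computes g1 xs y1 -> computes g2 xs y2 -> computes f [:: y1; y2] z ->
  computes (PComp f [:: g1; g2]) xs z.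
Proof.
move=> g1P g2P fP; apply: computes_comp fP.
apply: computes_all_cons g1P _; apply: computes_all_cons g2P _.
exact: computes_all_nil.
Qed.

Lemma computable2_fst : computable2 (fun x _ => x).
Proof. by exists (PProj 0) => x y; exact: computes_proj. Qed.

Lemma computable2_snd : computable2 (fun _ y => y).
Proof. by exists (PProj 1) => x y; exact: computes_proj. Qed.

Lemma computable2_comp h f g :
  computable2 h -> computable2 f -> computable2 g ->
  computable2 (fun x y => h (f x y) (g x y)).
Proof.
move=> [ph hP] [pf fP] [pg gP]; exists (PComp ph [:: pf; pg]) => x y.
exact: computes_comp2 (fP x y) (gP x y) (hP _ _).
Qed.

Lemma computable2_succ f : computable2 f -> computable2 (fun x y => (f x y).+1).
Proof.
move=> [p fP]; exists (PComp PSucc [:: p]) => x y.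
exact: computes_comp1 (fP x y) (computes_succ _).
Qed.

Lemma computable2_const c : computable2 (fun _ _ => c).
Proof.
elim: c => [|c IHc]; last exact: computable2_succ.
by exists PZero => x y; exact: computes_zero.
Qed.

(** The only recursion that is used.  The parameter list of [PRec] is
    [init; par], so that inside the loop the state and the parameter are the
    arguments number 1 and 3. *)
Lemma computable2_iter step n init par :
  computable2 step -> computable2 n -> computable2 init -> computable2 par ->
  computable2 (fun x y => iter (n x y) (fun s => step s (par x y)) (init x y)).
Proof.
move=> [ps sP] [pn nP] [pi iP] [pp pP].
exists (PComp (PRec (PProj 0) (PComp ps [:: PProj 1; PProj 3]))
              [:: pn; pi; pp]) => x y.
apply: (@computes_comp _ _ _ [:: n x y; init x y; par x y]).
  apply: computes_all_cons (nP x y) _; apply: computes_all_cons (iP x y) _.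
  apply: computes_all_cons (pP x y) _; exact: computes_all_nil.
elim: (n x y) => [|k IHk]; first by apply: computes_rec0; exact: computes_proj.
apply: computes_recS IHk _.
exact: computes_comp2 (computes_proj _ _) (computes_proj _ _) (sP _ _).
Qed.

Lemma computable2_ext f g : computable2 f -> f =2 g -> computable2 g.
Proof. by move=> [p fP] fg; exists p => x y; rewrite -fg. Qed.

(** A loop whose body discards its state leaves the initial value exactly when
    it is run zero times. *)
Lemma computable2_if b f g :
  computable2 b -> computable2 f -> computable2 g ->
  computable2 (fun x y => if b x y == 0 then f x y else g x y).
Proof.
move=> bP fP gP.
apply: (computable2_ext (computable2_iter computable2_snd bP fP gP)) => x y.
by case: (b x y) => //= k; elim: k => //=.
Qed.

Lemma computable2_add f g :
  computable2 f -> computable2 g -> computable2 (fun x y => f x y + g x y).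
Proof.
move=> fP gP; apply: (computable2_ext
  (computable2_iter (computable2_succ computable2_fst) fP gP gP)) => x y.
by elim: (f x y) => //= k ->.
Qed.

Lemma computable2_mul f g :
  computable2 f -> computable2 g -> computable2 (fun x y => f x y * g x y).
Proof.
move=> fP gP; apply: (computable2_ext (computable2_iter
  (computable2_add computable2_snd computable2_fst) fP
  (computable2_const 0) gP)) => x y.
by elim: (f x y) => //= k ->; rewrite mulSn.
Qed.

Definition PPred : prog := PComp (PRec PZero (PProj 0)) [:: PProj 0].

Lemma computes_pred f xs y :
  computes f xs y -> computes (PComp PPred [:: f]) xs y.-1.
Proof.
move=> fP; apply: computes_comp1 fP _.
apply: computes_comp1 (computes_proj _ _) _.
elim: y => [|y IHy]; first by apply: computes_rec0; exact: computes_zero.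
by apply: computes_recS IHy _; exact: computes_proj.
Qed.

Lemma computable2_pred f : computable2 f -> computable2 (fun x y => (f x y).-1).
Proof.
move=> [p fP]; exists (PComp PPred [:: p]) => x y; exact: computes_pred.
Qed.

Lemma computable2_sub f g :
  computable2 f -> computable2 g -> computable2 (fun x y => f x y - g x y).
Proof.
move=> fP gP; apply: (computable2_ext
  (computable2_iter (computable2_pred computable2_fst) gP fP gP)) => x y.
by elim: (g x y) => [|k /= ->]; rewrite ?subn0 ?subnS.
Qed.

Lemma computable2_exp2 f : computable2 f -> computable2 (fun x y => 2 ^ f x y).
Proof.
move=> fP; apply: (computable2_ext (computable2_iter
  (computable2_add computable2_fst computable2_fst) fP
  (computable2_const 1) fP)) => x y.
by elim: (f x y) => //= k ->; rewrite expnS mul2n addnn.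
Qed.

(** * Pairing and tables *)

(** Decoding a pair amounts to extracting a square root. *)
Definition sqrt_nat (x : nat) : nat :=
  iter x (fun s => if s.+1 * s.+1 - x == 0 then s.+1 else s) 0.

Lemma sqrt_natE x s : s * s <= x < s.+1 * s.+1 -> sqrt_nat x = s.
Proof.
move=> sx; suff /(_ x) : forall j, iter j
    (fun s => if s.+1 * s.+1 - x == 0 then s.+1 else s) 0 = minn j s.
  by rewrite -/(sqrt_nat x) => ->; nia.
elim=> [|j /= ->]; first by rewrite min0n.
case: ifP; rewrite subn_eq0 => /idP; case: (leqP j s); nia.
Qed.

Lemma computable2_sqrt f :
  computable2 f -> computable2 (fun x y => sqrt_nat (f x y)).
Proof.
move=> fP; apply: (computable2_iter
  (step := fun s z => if s.+1 * s.+1 - z == 0 then s.+1 else s)) => //.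
- have sP := computable2_succ computable2_fst.
  apply: (computable2_if _ sP computable2_fst).
  exact: computable2_sub (computable2_mul sP sP) computable2_snd.
- exact: computable2_const.
Qed.

(** As [(a + b) ^ 2 <= <a, b> < (a + b + 1) ^ 2], the sum [a + b] is the square
    root of the code.  This pairing is not onto, but it fulfils [<0, 0> = 0],
    and [0] decodes to zeros. *)
Definition pair_nat (a b : nat) : nat := (a + b) * (a + b) + a.
Definition left_nat (z : nat) : nat := z - sqrt_nat z * sqrt_nat z.
Definition right_nat (z : nat) : nat := sqrt_nat z - left_nat z.

Lemma sqrt_pair a b : sqrt_nat (pair_nat a b) = a + b.
Proof. by apply: sqrt_natE; rewrite /pair_nat; nia. Qed.

Lemma left_pair a b : left_nat (pair_nat a b) = a.
Proof. by rewrite /left_nat sqrt_pair addKn. Qed.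

Lemma right_pair a b : right_nat (pair_nat a b) = b.
Proof. by rewrite /right_nat left_pair sqrt_pair addKn. Qed.

Lemma leq_pair a b a' b' :
  a <= a' -> b <= b' -> pair_nat a b <= pair_nat a' b'.
Proof. by rewrite /pair_nat; nia. Qed.

Lemma computable2_pair f g : computable2 f -> computable2 g ->
  computable2 (fun x y => pair_nat (f x y) (g x y)).
Proof.
move=> fP gP; have sP := computable2_add fP gP.
exact: computable2_add (computable2_mul sP sP) fP.
Qed.

Lemma computable2_left f :
  computable2 f -> computable2 (fun x y => left_nat (f x y)).
Proof.
move=> fP; have sP := computable2_sqrt fP.
exact: computable2_sub fP (computable2_mul sP sP).
Qed.

Lemma computable2_right f :
  computable2 f -> computable2 (fun x y => right_nat (f x y)).
Proof.
move=> fP; exact: computable2_sub (computable2_sqrt fP) (computable2_left fP).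
Qed.

Lemma computable2_nth s f :
  computable2 f -> computable2 (fun x y => nth 0 s (f x y)).
Proof.
elim: s f => [|a s IHs] f fP.
  by apply: (computable2_ext (computable2_const 0)) => x y; rewrite nth_nil.
apply: (computable2_ext (computable2_if fP (computable2_const a)
  (IHs _ (computable2_pred fP)))) => x y.
by case: (f x y).
Qed.

(** * Words as numbers *)

(** The digits are 1 and 2 because 0 is reserved for the blank symbol.  The
    number [t] stands for the tape that follows the word. *)
Definition push (u : seq bool) (t : nat) : nat :=
  foldr (fun b : bool => pair_nat b.+1) t u.

Lemma push_cat u v t : push (u ++ v) t = push u (push v t).
Proof. by rewrite /push foldr_cat. Qed.

Lemma computable2_push u f :
  computable2 f -> computable2 (fun x y => push u (f x y)).
Proof.
move=> fP; elim: u => //= b u IHu.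
exact: computable2_pair (computable2_const _) IHu.
Qed.

(** A state [<r, t>] consists of a stack [r] that is emptied letter by letter
    onto [t]; a letter 0 shows that the stack is empty. *)
Definition pour_step (s : nat) : nat :=
  let r := left_nat s in
  if left_nat r == 0 then s
  else pair_nat (right_nat r) (pair_nat (left_nat r) (right_nat s)).

(** Each letter is at least 1, so a stack of code [c] has at most [c] letters,
    and [c] steps empty it. *)
Definition pour (c t : nat) : nat := right_nat (iter c pour_step (pair_nat c t)).

Lemma computable2_pour f g : computable2 f -> computable2 g ->
  computable2 (fun x y => pour (f x y) (g x y)).
Proof.
move=> fP gP; apply: computable2_right.
apply: (computable2_iter (step := fun s _ => pour_step s) (par := f)) => //.
- have sP := computable2_fst; have rP := computable2_left sP.
  apply: (computable2_if (computable2_left rP) sP).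
  apply: computable2_pair (computable2_right rP) _.
  exact: computable2_pair (computable2_left rP) (computable2_right sP).
- exact: computable2_pair.
Qed.

(** Pouring reverses the order, so a word is stored backwards in order to be
    written forwards. *)
Lemma pour_code u t : pour (push (rev u) 0) t = push u t.
Proof.
have size_le v : size v <= push v 0.
  by elim: v => //= b v; rewrite /pair_nat; nia.
have pourK v k s : size v <= k ->
    iter k pour_step (pair_nat (push v 0) s) = pair_nat 0 (push (rev v) s).
  elim: k v s => [|k IHk] [|b v] s //= vk.
  - rewrite -/(iter k.+1 pour_step _) iterSr.
    by rewrite {2}/pour_step left_pair; exact: (IHk [::]).
  - rewrite -/(iter k.+1 pour_step _) iterSr.
    rewrite {2}/pour_step !left_pair !right_pair /=.
    by rewrite IHk // rev_cons -cats1 push_cat.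
by rewrite /pour pourK ?revK ?right_pair // size_le.
Qed.

(** * Programs that know their own code *)

(** A template is a list of fixed pieces [Some u] and holes [None]. *)
Definition fill (tm : seq (option (seq bool))) (v : seq bool) : seq bool :=
  flatten [seq odflt v o | o <- tm].

Fixpoint numeral (c : nat) : prog :=
  if c is c'.+1 then PComp PSucc [:: numeral c'] else PZero.

Lemma computes_numeral c xs : computes (numeral c) xs c.
Proof.
elim: c => [|c IHc] /=; first exact: computes_zero.
exact: computes_comp1 IHc (computes_succ _).
Qed.

Definition numeral_prefix : seq bool :=
  encode_nat 3 ++ encode_nat 1 ++ encode_nat 1.

Lemma encode_numeral c :
  encode_prog (numeral c) = iter c (cat numeral_prefix) (encode_nat 0).
Proof. by elim: c => //= c ->; rewrite cats0. Qed.

(** A form of the recursion theorem: a program may use any word that is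
    assembled from copies of its own code.  Let [f] compute
    [G k (H c)], where [H c] is the number of the filled template under the
    assumption that [c] stores the code of [f]; then substitute for [c] the
    number that does store it.  Besides the code of [f], the code of the
    resulting program contains only the code of the numeral, which is periodic.
    So no general substitution on codes is required. *)
Lemma self_reference G tm : computable2 G ->
  exists p, forall k, computes p [:: k]
    (G k (push (fill tm (encode_prog p)) 0)).
Proof.
move=> GP.
(* [V c t] writes the code of [PComp f [:: PProj 0; numeral c]] in front of
   [t]; [H c] fills all holes of the template with that code. *)
pose V c t := push (encode_nat 3) (pour c
  (push (encode_nat 2 ++ encode_prog (PProj 0))
    (iter c (push numeral_prefix) (push (encode_nat 0) t)))).
pose H c := foldr (fun o t => if o is Some u then push u t else V c t) 0 tm.
have HP : computable2 (fun _ c => H c).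
  rewrite /H; elim: (tm) => [|[u|] tm' IHtm] /=; first exact: computable2_const.
    exact: computable2_push.
  apply: computable2_push; apply: computable2_pour computable2_snd _.
  apply: computable2_push.
  apply: (computable2_iter (step := fun s _ => push numeral_prefix s)
            (computable2_push _ computable2_fst) computable2_snd _
            computable2_snd).
  exact: computable2_push.
have [f fP] := computable2_comp GP computable2_fst HP.
pose c := push (rev (encode_prog f)) 0; pose p := PComp f [:: PProj 0; numeral c].
have VE t : V c t = push (encode_prog p) t.
  rewrite /p /V pour_code /= cats0 encode_numeral !push_cat /=.
  suff -> : push (iter c (cat numeral_prefix) (encode_nat 0)) t
          = iter c (push numeral_prefix) (push (encode_nat 0) t) by [].
  by elim: (c) => //= i ->.
have HE : H c = push (fill tm (encode_prog p)) 0.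
  rewrite /H /fill; elim: (tm) => //= o tm' ->.
  by case: o => [u|] /=; rewrite push_cat // VE.
exists p => k; rewrite -HE.
exact: computes_comp2 (computes_proj _ _) (computes_numeral _ _) (fP _ _).
Qed.

(** The words to which [self_reference] applies. *)
Definition schematic (F : prog -> seq bool) : Prop :=
  exists tm, forall p, F p = fill tm (encode_prog p).

Lemma schematic_const u : schematic (fun _ => u).
Proof. by exists [:: Some u] => p; rewrite /fill /= cats0. Qed.

Lemma schematic_hole : schematic encode_prog.
Proof. by exists [:: None] => p; rewrite /fill /= cats0. Qed.

Lemma schematic_cat F G :
  schematic F -> schematic G -> schematic (fun p => F p ++ G p).
Proof.
move=> [tF FE] [tG GE]; exists (tF ++ tG) => p.
by rewrite FE GE /fill map_cat flatten_cat.
Qed.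

Lemma schematic_flatten (I J : Type) (s : seq I) (t : seq J) F :
  (forall i j, schematic (F i j)) ->
  schematic (fun p => flatten [seq F i j p | i <- s, j <- t]).
Proof.
move=> FP; elim: s => [|i s IHs] /=; first exact: schematic_const.
have rowP : schematic (fun p => flatten [seq F i j p | j <- t]).
  by elim: t {IHs} => [|j t IHt] /=; [exact: schematic_const | exact: schematic_cat].
have [tm tmE] := schematic_cat rowP IHs.
by exists tm => p; rewrite -tmE flatten_cat.
Qed.

(** * Simulation of Turing machines *)

Definition stops_at (T : turing_machine) (w : seq bool) (t : nat) : bool :=
  (iter t (@tm_step T) (tm_init T w)).1.1.1 == tm_stop T.

Section Simulation.
Variable T : turing_machine.

(** Listing the blank and the two input symbols first gives them the codes 0,
    1 and 2, in agreement with [push], whatever the machine is.  The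
    repetitions in the list do no harm, since [index] finds the first
    occurrence. *)
Definition symbols : seq (tm_symbol T) :=
  [:: tm_blank T, tm_input T false, tm_input T true & enum (tm_symbol T)].

Definition symbol_code (a : tm_symbol T) : nat := index a symbols.
Definition symbol_of (i : nat) : tm_symbol T := nth (tm_blank T) symbols i.
Definition state_code (q : tm_state T) : nat := index q (enum (tm_state T)).
Definition state_of (i : nat) : tm_state T :=
  nth (tm_start T) (enum (tm_state T)) i.

Lemma symbol_in a : a \in symbols.
Proof. by rewrite !inE mem_enum !orbT. Qed.

Lemma symbol_codeK : cancel symbol_code symbol_of.
Proof. by move=> a; exact: nth_index (symbol_in a). Qed.

Lemma state_codeK : cancel state_code state_of.
Proof. by move=> q; apply: nth_index; rewrite mem_enum. Qed.

Lemma symbol_code_blank : symbol_code (tm_blank T) = 0.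
Proof. by rewrite /symbol_code /= eqxx. Qed.

Lemma symbol_code_input b : symbol_code (tm_input T b) = b.+1.
Proof.
rewrite /symbol_code /= eq_sym (negbTE (tm_input_blank T b)).
by case: b; rewrite ?eqxx // (inj_eq (@tm_input_inj T)).
Qed.

Definition tape_code (l : seq (tm_symbol T)) : nat :=
  foldr (fun a => pair_nat (symbol_code a)) 0 l.

Lemma tape_code_input w : tape_code [seq tm_input T b | b <- w] = push w 0.
Proof. by elim: w => //= b w ->; rewrite symbol_code_input. Qed.

(** Since [<0, 0> = 0], the empty list decodes to a blank symbol followed by the
    empty list, as the conventions for the ends of the tape demand. *)
Lemma left_tape l : left_nat (tape_code l) = symbol_code (head (tm_blank T) l).
Proof. by case: l => [|a l] /=; rewrite ?left_pair ?symbol_code_blank. Qed.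

Lemma right_tape l : right_nat (tape_code l) = tape_code (behead l).
Proof. by case: l => [|a l] /=; rewrite ?right_pair. Qed.

Definition config_code (c : tm_config T) : nat :=
  let: (q, l, a, r) := c in
  pair_nat (state_code q)
    (pair_nat (tape_code l) (pair_nat (symbol_code a) (tape_code r))).

Definition move_code (d : move) : nat :=
  match d with MLeft => 0 | MStay => 1 | MRight => 2 end.

(** The transition function is extended to all numbers by default values, and
    then tabulated as far as the codes of states and symbols reach.  A finite
    table is computable whatever its entries are. *)
Definition trans_code (z : nat) : nat :=
  let: (q, b, d) := tm_trans (state_of (left_nat z)) (symbol_of (right_nat z)) in
  pair_nat (state_code q) (pair_nat (symbol_code b) (move_code d)).

Definition trans_table : seq nat :=
  mkseq trans_code (pair_nat #|tm_state T| (size symbols)).+1.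

Lemma trans_tableE q a :
  nth 0 trans_table (pair_nat (state_code q) (symbol_code a)) =
  let: (q', b, d) := tm_trans q a in
  pair_nat (state_code q') (pair_nat (symbol_code b) (move_code d)).
Proof.
rewrite nth_mkseq.
  by rewrite /trans_code left_pair right_pair state_codeK symbol_codeK.
by rewrite ltnS leq_pair ?index_size // cardE index_size.
Qed.

Definition step_nat (z : nat) : nat :=
  let l := left_nat (right_nat z) in
  let r := right_nat (right_nat (right_nat z)) in
  let e := nth 0 trans_table
             (pair_nat (left_nat z) (left_nat (right_nat (right_nat z)))) in
  let b := left_nat (right_nat e) in
  let d := right_nat (right_nat e) in
  pair_nat (left_nat e)
    (if d == 0
     then pair_nat (right_nat l) (pair_nat (left_nat l) (pair_nat b r))
     else if d.-1 == 0 then pair_nat l (pair_nat b r)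
     else pair_nat (pair_nat b l) (pair_nat (left_nat r) (right_nat r))).

Lemma step_natE c : step_nat (config_code c) = config_code (tm_step c).
Proof.
case: c => [[[q l] a] r]; rewrite /step_nat /config_code /tm_step.
rewrite !(left_pair, right_pair) trans_tableE.
case: (tm_trans q a) => [[q' b] d]; rewrite !(left_pair, right_pair).
by case: d; rewrite /= ?left_tape ?right_tape.
Qed.

Lemma computable2_step_nat : computable2 (fun z _ => step_nat z).
Proof.
have zP := computable2_fst; have rP := computable2_right zP.
have rrP := computable2_right rP; have lP := computable2_left rP.
have rrrP := computable2_right rrP.
have eP := computable2_nth trans_table
  (computable2_pair (computable2_left zP) (computable2_left rrP)).
have bP := computable2_left (computable2_right eP).
have dP := computable2_right (computable2_right eP).
have brP := computable2_pair bP rrrP.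
apply: (computable2_pair (computable2_left eP)).
apply: (computable2_if dP).
  apply: (computable2_pair (computable2_right lP)).
  exact: (computable2_pair (computable2_left lP)).
apply: (computable2_if (computable2_pred dP) (computable2_pair lP brP)).
apply: (computable2_pair (computable2_pair bP lP)).
exact: (computable2_pair (computable2_left rrrP) (computable2_right rrrP)).
Qed.

(** The clock [t] in [<t, c>] advances with the machine.  It has to be halted
    explicitly: a machine may leave its stop state, and only the first visit
    counts.  The sum of the two truncated differences vanishes if and only if
    the state is the stop state. *)
Definition clock_step (s : nat) : nat :=
  let q := left_nat (right_nat s) in
  let h := state_code (tm_stop T) in
  if (q - h) + (h - q) == 0 then s
  else pair_nat (left_nat s).+1 (step_nat (right_nat s)).

Lemma clock_stepE t c :
  clock_step (pair_nat t (config_code c)) =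
  if c.1.1.1 == tm_stop T then pair_nat t (config_code c)
  else pair_nat t.+1 (config_code (tm_step c)).
Proof.
case: c => [[[q l] a] r]; rewrite /clock_step !(left_pair, right_pair) step_natE.
by rewrite /= addn_eq0 !subn_eq0 -(can_eq state_codeK) eqn_leq.
Qed.

Definition clock (k t : nat) : nat :=
  left_nat (iter k clock_step
    (pair_nat 0 (pair_nat (state_code (tm_start T))
       (pair_nat 0 (pair_nat (left_nat t) (right_nat t)))))).

Lemma computable2_clock : computable2 clock.
Proof.
apply: computable2_left.
apply: (computable2_iter (step := fun s _ => clock_step s)
          (par := fun x _ => x)) => //; try exact: computable2_fst.
- have sP := computable2_fst; have rP := computable2_right sP.
  have qP := computable2_left rP.
  have hP := computable2_const (state_code (tm_stop T)).
  apply: (computable2_if _ sP).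
    exact: (computable2_add (computable2_sub qP hP) (computable2_sub hP qP)).
  apply: (computable2_pair (computable2_succ (computable2_left sP))).
  exact: (computable2_comp computable2_step_nat rP rP).
- have tP := computable2_snd.
  apply: (computable2_pair (computable2_const 0)).
  apply: (computable2_pair (computable2_const _)).
  apply: (computable2_pair (computable2_const 0)).
  exact: (computable2_pair (computable2_left tP) (computable2_right tP)).
Qed.

(** [find] returns the length of the list when nothing is found, so the right
    hand side is the halting time cut off at [k]. *)
Lemma clockE k w : clock k (push w 0) = find (stops_at T w) (iota 0 k).
Proof.
have -> : clock k (push w 0) =
    left_nat (iter k clock_step (pair_nat 0 (config_code (tm_init T w)))).
  by rewrite /clock -tape_code_input left_tape right_tape.
suff -> : iter k clock_step (pair_nat 0 (config_code (tm_init T w))) =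
    let m := find (stops_at T w) (iota 0 k) in
    pair_nat m (config_code (iter m (@tm_step T) (tm_init T w))).
  by rewrite left_pair.
elim: k => [//|k]; rewrite iterS => ->.
rewrite clock_stepE -/(stops_at T w _) -(addn1 k) iotaD find_cat.
case: (boolP (has _ _)) => [hk|nk].
  have := nth_find 0 hk; rewrite nth_iota ?add0n => [->|] //.
  by rewrite -{2}(size_iota 0 k) -has_find.
rewrite (hasNfind nk) size_iota add0n /=.
by case: ifP; rewrite ?addn0 ?addn1.
Qed.

End Simulation.

(** * Computable reals that record a halting time *)

Local Open Scope ring_scope.

Definition descr_nat (c : nat) : real_descr :=
  RealDescr (numeral c) (numeral 1) PZero.

Definition descr_inv (p : prog) : real_descr :=
  RealDescr (numeral 1) p PZero.

(** Since [1 - 1 / b = (b - 1) / b], the program for [1 / b] also describes the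
    complementary probability. *)
Definition descr_compl_inv (p : prog) : real_descr :=
  RealDescr (PComp PPred [:: p]) p PZero.

Lemma describes_nat (R : realType) c : describes_real (descr_nat c) (c%:R : R).
Proof.
move=> k; exists c, 1%N, 0%N; split => //; try exact: computes_numeral.
  exact: computes_zero.
by rewrite expr0 mul1r divr1 subrr normr0 invr_gt0 exprn_gt0.
Qed.

Section DescribesInv.
Variables (R : realType) (p : prog) (m : nat -> nat) (e : R).
Hypothesis pP : forall k, computes p [:: k] (2 ^ m k).
Hypothesis eP : forall k, `|e - 2 ^- m k| < 2 ^- k.

Lemma describes_inv : describes_real (descr_inv p) e.
Proof.
move=> k; exists 1%N, (2 ^ m k)%N, 0%N; split=> //.
- exact: computes_numeral.
- exact: computes_zero.
- by rewrite -lt0n expn_gt0.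
- by rewrite expr0 mulr1 mul1r natrX.
Qed.

Lemma describes_compl_inv : describes_real (descr_compl_inv p) (1 - e).
Proof.
move=> k; exists (2 ^ m k).-1, (2 ^ m k)%N, 0%N; split=> //.
- exact: computes_pred.
- exact: computes_zero.
- by rewrite -lt0n expn_gt0.
- rewrite expr0 mul1r -subn1 natrB ?expn_gt0 // natrX mulrBl mul1r.
  rewrite divff ?expf_neq0 // distrC opprB [_ + (e - 1)]addrC addrA subrK.
  exact: eP.
Qed.

End DescribesInv.

(** A number whose positivity is a halting problem.  If the first [k + 1]
    steps show no success, then both [e] and the approximation lie in
    [[0, 2 ^ - (k + 1)]]; afterwards the approximation is exact. *)
Lemma halting_real (R : realType) (P : pred nat) : exists e : R,
  [/\ 0 <= e <= 1, (exists t, P t) <-> 0 < e &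
      forall k, `|e - 2 ^- find P (iota 0 k.+1)| < 2 ^- k].
Proof.
have gt0 k : 0 < 2 ^- k :> R by rewrite invr_gt0 exprn_gt0.
have ltS k : 2 ^- k.+1 < 2 ^- k :> R.
  by rewrite ltf_pV2 ?posrE ?exprn_gt0 // ltr_eXn2l ?ltr1n.
have noP k : ~~ has P (iota 0 k) -> find P (iota 0 k) = k.
  by move=> /hasNfind ->; rewrite size_iota.
have [exP|nexP] := pselect (exists t, P t); last first.
  exists 0; split; [by rewrite lexx ler01 | by rewrite ltxx; split|move=> k].
  rewrite noP ?sub0r ?normrN ?gtr0_norm //.
  by apply/hasPn => t _; apply/negP => Pt; apply: nexP; exists t.
exists (2 ^- ex_minn exP); case: ex_minnP => t Pt t_min; split.
- by rewrite ltW //= invf_le1 ?exprn_gt0 // exprn_ege1 // ler1n.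
- by split.
- move=> k; have [tk|kt] := ltnP t k.+1.
    have hk : has P (iota 0 k.+1).
      by apply/hasP; exists t; rewrite ?mem_iota.
    have fk : (find P (iota 0 k.+1) < k.+1)%N.
      by rewrite -{2}(size_iota 0 k.+1) -has_find.
    suff -> : find P (iota 0 k.+1) = t by rewrite subrr normr0.
    apply/eqP; rewrite eqn_leq; apply/andP; split.
      rewrite leqNgt; apply/negP => /(before_find 0%N).
      by rewrite nth_iota // add0n Pt.
    by apply: t_min; have := nth_find 0%N hk; rewrite nth_iota.
  rewrite noP; last first.
    apply/hasPn => i; rewrite mem_iota add0n /= => ik; apply/negP => /t_min ti.
    by have := leq_trans ik (leq_trans kt ti); rewrite ltnn.
  have le2 : 2 ^- t <= 2 ^- k.+1 :> R.
    by rewrite lef_pV2 ?posrE ?exprn_gt0 // ler_eXn2l ?ltr1n.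
  rewrite distrC ger0_norm ?subr_ge0 //.
  by rewrite (le_lt_trans _ (ltS k)) // gerBl ltW.
Qed.

(** * Zero-error capacity with and without feedback *)

(** A word that repeats the common output is possible for all inputs, so
    orthogonal sets have at most one element. *)
Lemma C0_common_output (R : realType) (X Y : finType) (W : X -> Y -> R) (y : Y) :
  (forall x, W x y != 0) -> C0 W = 0%E.
Proof.
move=> Wy; have M1 m : (max_orthogonal W m <= 1)%N.
  apply/bigmax_leqP => S /forall_inP oS; apply/card_le1_eqP => x x' xS x'S.
  apply/eqP; rewrite eq_sym; apply: contraT => xx'.
  have /forall_inP/(_ _ x'S)/implyP/(_ xx')/forallP := oS x xS.
  move=> /(_ [tuple of nseq m y]).
  suff nz z : block_channel W z [tuple of nseq m y] != 0.
    by rewrite (negbTE (nz x)) (negbTE (nz x')).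
  by apply/prodf_neq0 => j _; rewrite tnth_nseq.
have M0 m : log2 (max_orthogonal W m)%:R = 0 :> R.
  rewrite /log2; case: (max_orthogonal W m) (M1 m) => [|[|//]] _.
    by rewrite ln0 ?mul0r.
  by rewrite ln1 mul0r.
rewrite /C0 (_ : (fun m => _) = cst 0%E); last first.
  by apply/funext => m; rewrite M0 mul0r.
by rewrite is_cvg_limn_einfE; [exact: lim_cst | exact: is_cvg_cst].
Qed.

Lemma log2_2X (R : realType) m : log2 (2 ^+ m : R) = m%:R.
Proof.
have ln2 : 0 < ln 2 :> R by rewrite ln_gt0 ?ltr1n.
by rewrite /log2 lnXn // -[ln 2 *+ m]mulr_natl mulfK // gt_eqF.
Qed.

(** Two letters without a common output transmit one bit per use: the [2 ^ m]
    words over these letters are mutually orthogonal. *)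
Lemma C0_separated_inputs (R : realType) (X Y : finType) (W : X -> Y -> R)
    (x0 x1 : X) :
  x0 != x1 -> (forall y, (W x0 y == 0) || (W x1 y == 0)) -> (1 <= C0 W)%E.
Proof.
move=> x01 W01; pose letter (b : bool) := if b then x1 else x0.
have letter_inj : injective letter.
  by case=> [] [] //= /eqP; rewrite ?(eq_sym x1) (negbTE x01).
have W_letter b b' y : b != b' -> (W (letter b) y == 0) || (W (letter b') y == 0).
  by case: b b' => [] [] // _; rewrite /= 1?orbC W01.
have M2 m : (2 ^ m <= max_orthogonal W m)%N.
  pose word (t : m.-tuple bool) : m.-tuple X := [tuple of map letter t].
  have word_inj : injective word.
    move=> t t' /(congr1 val) /= /(inj_map letter_inj); exact: val_inj.
  pose S : {set m.-tuple X} := [set word t | t : m.-tuple bool].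
  have cS : #|S| = (2 ^ m)%N by rewrite card_imset // card_tuple card_bool.
  rewrite -cS; apply: (@leq_bigmax_cond _ _ (fun S : {set m.-tuple X} => #|S|)).
  apply/forall_inP => _ /imsetP[t _ ->]; apply/forall_inP => _ /imsetP[t' _ ->].
  apply/implyP => tt'.
  have /existsP[j tj] : [exists j, tnth t j != tnth t' j].
    apply: contraNT tt'; rewrite negb_exists => /forallP e.
    by apply/eqP; congr word; apply: eq_from_tnth => j; have /negPn/eqP := e j.
  apply/forallP => y; have := W_letter _ _ (tnth y j) tj.
  by case/orP => /eqP Wj; apply/orP; [left|right]; apply/eqP;
    rewrite /block_channel (bigD1 j) //= tnth_map Wj mul0r.
rewrite /C0 limn_einf_lim; rewrite (cvg_lim _ (@cvg_einfs_sup _ _)) //.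
(* The term of index 0 is 0, so the tail that is bounded below starts at 1. *)
apply: le_ereal_sup_tmp; exists (einfs
  (fun m : nat => (log2 (max_orthogonal W m)%:R / m%:R)%:E) 1); first by exists 1%N.
apply: le_ereal_inf_tmp => _ [m /= m1 <-]; rewrite lee_fin.
rewrite ler_pdivlMr ?ltr0n // mul1r -(log2_2X R m) ler_pM2r; last first.
  by rewrite invr_gt0 ln_gt0 ?ltr1n.
rewrite ler_ln ?posrE ?exprn_gt0 ?ltr0n //.
  by rewrite -natrX ler_nat.
by rewrite (leq_trans _ (M2 m)) // expn_gt0.
Qed.

Lemma sum_indicator (R : realType) (X : finType) (Q : pred X) (a : X) :
  \sum_(x | Q x) (x == a)%:R = (Q a)%:R :> R.
Proof.
rewrite big_mkcond (bigD1 a) //= eqxx big1 ?addr0; first by case: (Q a).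
by move=> x /negbTE ->; case: (Q x).
Qed.

(** The uniform distribution on the two letters is used as a test in the maximum:
    each output can be caused by at most one of them, so it collects mass at
    most 1/2. *)
Lemma C0FB_separated_inputs (R : realType) (X Y : finType) (W : X -> Y -> R)
    (x0 x1 : X) :
  x0 != x1 -> (forall y, (W x0 y == 0) || (W x1 y == 0)) -> (1 <= C0FB W)%E.
Proof.
move=> x01 W01; have C1 := C0_separated_inputs x01 W01.
rewrite /C0FB ifN; last first.
  by apply: contraTN C1 => /eqP ->; rewrite -ltNge lte_fin ltr01.
pose P x : R := ((x == x0)%:R + (x == x1)%:R) / 2.
have PE (Q : pred X) : \sum_(x | Q x) P x = ((Q x0)%:R + (Q x1)%:R) / 2.
  by rewrite -mulr_suml big_split /= !sum_indicator.
apply: le_ereal_sup_tmp; eexists.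
  exists P; last reflexivity.
  split=> [x|]; first by rewrite divr_ge0 ?addr_ge0 ?ler0n.
  by rewrite (PE xpredT) divff // (@pnatr_eq0 R 2).
apply: le_bigmin => [|y _]; first by rewrite leey.
rewrite PE /log2_inv; case: eqP => [_|]; first by rewrite leey.
rewrite lee_fin => s0.
have {s0} -> : ((0 < W x0 y)%R)%:R + ((0 < W x1 y)%R)%:R = 1 :> R.
  move: s0; case/orP: (W01 y) => /eqP ->; rewrite ltxx ?add0r ?addr0;
  by case: (0 < _) => //; rewrite mul0r.
by rewrite div1r invf_div divr1 -(expr1 2) log2_2X.
Qed.

(** * The plant *)

Lemma eigenvalue_1 (F : fieldType) n (z : F) :
  eigenvalue (1%:M : 'M[F]_n) z -> z = 1.
Proof.
case/eigenvalueP => v; rewrite mulmx1 => vz v0; apply/eqP.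
have : (z - 1) *: v == 0 by rewrite scalerBl -vz scale1r subrr.
by rewrite scaler_eq0 (negbTE v0) orbF subr_eq0.
Qed.

Lemma complex_mx1 (R : realType) n : complex_mx (1%:M : 'M[R]_n) = 1%:M.
Proof. exact: map_mx1. Qed.

Lemma eta_1 (R : realType) n : eta (1%:M : 'M[R]_n) = 0.
Proof.
rewrite /eta /eigenvalues complex_mx1.
case: closed_field_poly_normal => r /= rE.
rewrite big_seq_cond big1 // => z /andP[zr _].
have -> : z = 1.
  apply: (@eigenvalue_1 _ n); rewrite eigenvalue_root_char rE.
  by rewrite rootZ ?root_prod_XsubC // lead_coef_eq0 monic_neq0 // char_poly_monic.
by rewrite /cabs ComplexField.Normc.normc1 /log2 ln1 mul0r.
Qed.

Lemma eigenvalue_1_1 (F : fieldType) n : (0 < n)%N -> eigenvalue (1%:M : 'M[F]_n) 1.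
Proof.
case: n => // n _; apply/eigenvalueP; exists (const_mx 1).
  by rewrite mulmx1 scale1r.
by apply/eqP => /rowP /(_ ord0) /eqP; rewrite !mxE oner_eq0.
Qed.

(** * The family of channels *)

Section FlipChannel.
Variables (X Y : finType) (x0 x1 : X) (y0 y1 : Y).
Hypotheses (x01 : x0 != x1) (y01 : y0 != y1).

(** Descriptions and probabilities depend on the letters in the same way, so
    one definition serves for both. *)
Definition flip_family (A : Type) (a0 a1 b c : A) (x : X) (y : Y) : A :=
  if x == x0 then if y == y0 then c else if y == y1 then b else a0
  else if y == y1 then a1 else a0.

Definition flip_channel (R : realType) (e : R) : X -> Y -> R :=
  flip_family 0 1 e (1 - e).

Lemma flip_channel_distr (R : realType) (e : R) :
  0 <= e <= 1 -> forall x, is_distribution (flip_channel e x).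
Proof.
move=> /andP[e0 e1] x; rewrite /flip_channel /flip_family; split=> [y|].
  by do !case: ifP => _ //; rewrite subr_ge0.
rewrite (bigD1 y0) // (bigD1 y1) /= 1?eq_sym //.
rewrite big1 => [|y /andP[/negbTE n0 /negbTE n1]].
  rewrite eqxx (negbTE y01) (eq_sym y1) (negbTE y01) !addr0.
  by case: ifP; rewrite ?eqxx ?subrK ?add0r.
by rewrite n0 n1; case: ifP.
Qed.

Lemma C0FB_flip_channel0 (R : realType) : (1 <= C0FB (flip_channel (0 : R)))%E.
Proof.
apply: C0FB_separated_inputs x01 _ => y; rewrite /flip_channel /flip_family eqxx.
rewrite (eq_sym x1) (negbTE x01).
have [->|_] := eqVneq y y0; first by rewrite (negbTE y01) eqxx orbT.
by case: ifP => _; rewrite eqxx.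
Qed.

Lemma C0FB_flip_channel_gt0 (R : realType) (e : R) :
  0 < e -> C0FB (flip_channel e) = 0%E.
Proof.
move=> e0; rewrite /C0FB (C0_common_output (y := y1)) ?eqxx // => x.
rewrite /flip_channel /flip_family eqxx (eq_sym y1) (negbTE y01).
by case: ifP => _; rewrite ?oner_neq0 // gt_eqF.
Qed.

Definition flip_descr (p : prog) : X -> Y -> real_descr :=
  flip_family (descr_nat 0) (descr_nat 1) (descr_inv p) (descr_compl_inv p).

Definition flip_word (p : prog) : seq bool :=
  flatten [seq encode_real_descr (flip_descr p x y) | x <- enum X, y <- enum Y].

Lemma schematic_flip_word : schematic flip_word.
Proof.
have cP := schematic_const; have hP := schematic_hole.
have invP : schematic (fun p => encode_real_descr (descr_inv p)).
  exact: (schematic_cat (cP (encode_prog (numeral 1)))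
           (schematic_cat hP (cP (encode_prog PZero)))).
have compl_invP : schematic (fun p => encode_real_descr (descr_compl_inv p)).
  have numP := schematic_cat
    (cP (encode_nat 3 ++ encode_prog PPred ++ encode_nat 1))
    (schematic_cat hP (cP [::])).
  exact: (schematic_cat numP (schematic_cat hP (cP (encode_prog PZero)))).
apply: schematic_flatten => x y; rewrite /flip_descr /flip_family.
by case: (x == x0) (y == y0) (y == y1) => [] [] [] //; exact: cP.
Qed.

Lemma describes_flip (R : realType) (p : prog) (e : R) :
  describes_real (descr_inv p) e ->
  describes_real (descr_compl_inv p) (1 - e) ->
  forall x y, describes_real (flip_descr p x y) (flip_channel e x y).
Proof.
move=> pe pe' x y; rewrite /flip_descr /flip_channel /flip_family.
by do ![case: ifP => _] => //; exact: describes_nat.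
Qed.

End FlipChannel.

(** * Undecidability *)

Theorem theorem36 (R : realType) (n : nat) (X Y : finType)
    (hn : (0 < n)%N) (hX : (1 < #|X|)%N) (hY : (1 < #|Y|)%N) :
  ~ semi_decidable (@describes_pair R n X Y)
      (@computable_plant R n `*` @computable_channel R X Y)
      (@stability_possible_FB R n X Y).
Proof.
move=> [T TP].
have /card_gt1P[x0 [x1 [_ _ x01]]] := hX.
have /card_gt1P[y0 [y1 [_ _ y01]]] := hY.
pose dA (i j : 'I_n) := descr_nat (i == j).
have dAP i j : describes_real (dA i j) ((1%:M : 'M[R]_n) i j).
  by rewrite mxE; exact: describes_nat.
pose wA := flatten [seq encode_real_descr (dA i j) | i <- enum 'I_n, j <- enum 'I_n].
pose w p := wA ++ flip_word x0 y0 y1 p.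
have [tm wE] : schematic w.
  by apply: schematic_cat (schematic_flip_word _ _ _); exact: schematic_const.
(* With the cut-off at [k + 1] instead of [k], the error is strictly less
   than [2 ^ - k], as a description of a real requires. *)
have GP : computable2 (fun k t => 2 ^ clock T k.+1 t)%N.
  apply: computable2_exp2.
  exact: (computable2_comp (computable2_clock T)
            (computable2_succ computable2_fst) computable2_snd).
have [p pP] := self_reference tm GP.
have {}pP k : computes p [:: k] (2 ^ find (stops_at T (w p)) (iota 0 k.+1))%N.
  by rewrite -clockE wE; exact: pP.
have [e [e01 stopsE eP]] := halting_real R (stops_at T (w p)).
have dW := describes_flip x0 y0 y1 (describes_inv pP eP) (describes_compl_inv pP eP).
pose W := flip_channel x0 y0 y1 e.
have plant1 : computable_plant (1%:M : 'M[R]_n).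
  split; first by move=> i j; exists (dA i j).
  exists 1; first by rewrite complex_mx1 eigenvalue_1_1.
  by rewrite /cabs ComplexField.Normc.normc1.
have chanW : computable_channel W.
  split; first exact: flip_channel_distr.
  by move=> x y; eexists; exact: dW.
have [||stops_in stops_out] := TP (1%:M, W) (w p).
- by split.
- exists wA, (flip_word x0 y0 y1 p); split=> //; first by exists dA.
  by exists (flip_descr x0 y0 y1 p).
have tm_stopsE : tm_stops T (w p) <-> 0 < e.
  rewrite -stopsE; split=> -[t]; first by move=> /eqP; exists t.
  by move=> /eqP; exists t.
have [e0|e0] := ltP 0 e.
  apply: stops_out; last exact/tm_stopsE.
  by case=> _ _ /=; rewrite eta_1 C0FB_flip_channel_gt0 // ltxx.
have {e0}e0 : e = 0 by apply/eqP; rewrite eq_le e0; case/andP: e01.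
have possible : stability_possible_FB (1%:M : 'M[R]_n, W).
  split; [exact: plant1 | exact: chanW | rewrite /W e0 /= eta_1].
  apply: (@lt_le_trans _ _ 1%E); first by rewrite lte_fin ltr01.
  exact: (C0FB_flip_channel0 x01 y01 R).
by have := stops_in possible; rewrite tm_stopsE e0 ltxx.
Qed.
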